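(* Let $k \ge 0$ and $n$ be integers, and let $A$ be a set of $n$ integers. Suppose that $n \ge (k^2+7k)/2$. Then \[ \frac{|(k+1)\wedge A|}{|k\wedge A|} \le \frac{n-k}{k+1}. \]
   Context: For a finite set $A \subseteq \mathbb{Z}$ and an integer $j \ge 0$, $j\wedge A$ denotes the set of integers that can be expressed as a sum of $j$ distinct elements of $A$ (the ''$j$-sums'' of $A$). *)

(* Defs.v *)
From HB Require Import structures.
From mathcomp Require Import all_boot all_order all_algebra finmap.
Set Implicit Arguments.
Unset Strict Implicit.
Unset Printing Implicit Defensive.

Import Order.TTheory GRing.Theory Num.Theory.
Local Open Scope fset_scope.
Local Open Scope ring_scope.

Definition jsums (j : nat) (A : {fset int}) : {fset int} :=
  [fset \sum_(x <- (B : {fset int})) x | B in fpowerset A & #|` B| == j].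

Lemma in_jsums (j : nat) (A : {fset int}) (s : int) :
  reflect (exists B : {fset int},
             [/\ B `<=` A, #|` B| = j & s = \sum_(x <- B) x])
          (s \in jsums j A).
Proof.
apply: (iffP (imfsetP _ _ _ _)) => /= [[B]|[B [BA Bj ->]]].
  by rewrite !inE fpowersetE => /andP[BA /eqP Bj] ->; exists B.
by exists B; rewrite // !inE fpowersetE BA Bj eqxx.
Qed.

(* Main.v *)
(* Join y in (k+1)^A to x = y - a in k^A whenever some representation of y
   contains a, and give each of the deg y edges at y the weight 1 / deg y, so
   that the total weight is |(k+1)^A|.  It suffices that every x receives at
   most (n-k)/(k+1).  Always deg y >= k+1, and deg y >= k+3 once y has two
   representations.  If x has a unique representation S, its edges correspond
   to A \ S, so there are only n-k of them.  If x has two representations S and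
   T, it may have n edges, but for a outside S u T the sum x + a has the two
   representations S u {a} and T u {a}, so at most 2k edges weigh more than
   1/(k+3); the hypothesis on n is exactly what the resulting bound requires. *)
Require Import Defs.
From HB Require Import structures.
From mathcomp Require Import all_boot all_order all_algebra finmap.
From mathcomp Require Import zify ring lra.
Set Implicit Arguments.
Unset Strict Implicit.
Unset Printing Implicit Defensive.

Import Order.TTheory GRing.Theory Num.Theory.
Local Open Scope fset_scope.
Local Open Scope ring_scope.

Lemma sum_fset_sub (V : nmodType) (T : choiceType) (A B : {fset T})
    (F : T -> V) :
  B `<=` A -> \sum_(a <- A | a \in B) F a = \sum_(a <- B) F a.
Proof.
move=> BA; rewrite big_fset_condE; apply: eq_fbigl => a.
by rewrite in_fset [LHS]inE /= andb_idl // => /(fsubsetP BA).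
Qed.

Lemma sum_fset_const (R : pzRingType) (T : choiceType) (A : {fset T}) (c : R) :
  \sum_(a <- A) c = (#|` A|)%:R * c.
Proof. by rewrite big_const_seq count_predT iter_addr_0 mulr_natl. Qed.

Lemma cardfsU_eq_sum (B C : {fset int}) :
  B != C -> #|` B| = #|` C| -> \sum_(x <- B) x = \sum_(x <- C) x ->
  (#|` B|.+2 <= #|` B `|` C|)%N.
Proof.
move=> neqBC cardBC sumBC; rewrite leqNgt; apply/negP => ltU.
have cardBD := cardfsID C B; have cardCD := cardfsID B C.
have cardU := cardfsUI B C; rewrite fsetIC in cardCD.
have /eqP : #|` B `\` C| = #|` C `\` B| by lia.
have : (#|` B `\` C| <= 1)%N by lia.
rewrite leq_eqVlt ltnS leqn0 => /orP[B1|B0] /eqP eqD; last first.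
  move: B0; rewrite cardfs_eq0 fsetD_eq0 => BC.
  by case/negP: neqBC; rewrite eqEfcard BC cardBC leqnn.
have /cardfs1P[c defc] : #|` C `\` B| == 1%N by rewrite -eqD.
have /cardfs1P[b defb] := B1.
have : b = c.
  move: sumBC; rewrite (big_fsetID _ (mem C)) /= [RHS](big_fsetID _ (mem B)) /=.
  have -> : [fset x in B | x \in C] = B `&` C.
    by apply/fsetP => x; rewrite !inE.
  have -> : [fset x in C | x \in B] = B `&` C.
    by apply/fsetP => x; rewrite !inE andbC.
  have -> : [fset x in B | x \notin C] = [fset b].
    by rewrite -defb; apply/fsetP => x; rewrite !inE andbC.
  have -> : [fset x in C | x \notin B] = [fset c].
    by rewrite -defc; apply/fsetP => x; rewrite !inE andbC.
  by rewrite !big_seq_fset1 => /addrI.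
move=> bc; have : b \in B `\` C by rewrite defb inE.
have : b \in C `\` B by rewrite defc bc inE.
by rewrite !inE => /andP[/negP nb _] /andP[_ /nb].
Qed.

Section EdgeWeights.
Variables (k : nat) (A : {fset int}).

Definition upper_edges (y : int) : {fset int} :=
  [fset a in A | y - a \in jsums k (A `\ a)].

Definition lower_edges (x : int) : {fset int} :=
  [fset a in A | x \in jsums k (A `\ a)].

Lemma mem_upper_edges (x a : int) :
  (a \in upper_edges (x + a)) = (a \in lower_edges x).
Proof. by rewrite !inE /= addrK. Qed.

Lemma sub_upper_edges (B : {fset int}) :
  B `<=` A -> #|` B| = k.+1 -> B `<=` upper_edges (\sum_(x <- B) x).
Proof.
move=> BA cardB; apply/fsubsetP => a aB.
rewrite !inE /= (fsubsetP BA) //=; apply/in_jsums; exists (B `\ a); split.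
- exact: fsetSD.
- by have := cardfsD1 a B; rewrite aB cardB => -[].
- by rewrite (big_fsetD1 a) //= addrAC subrr add0r.
Qed.

Lemma sub_upper_edgesU1 (S : {fset int}) (a : int) :
  S `<=` A -> #|` S| = k -> a \in A -> a \notin S ->
  a |` S `<=` upper_edges (\sum_(x <- S) x + a).
Proof.
move=> SA cardS aA aS; rewrite addrC -big_fsetU1 //.
apply: sub_upper_edges; last by rewrite cardfsU1 aS cardS.
by rewrite fsubUset fsub1set aA.
Qed.

Lemma card_upper_edges_jsums (y : int) :
  y \in jsums k.+1 A -> (k < #|` upper_edges y|)%N.
Proof.
case/in_jsums => B [BA cardB ->]; rewrite -cardB.
exact/fsubset_leq_card/sub_upper_edges.
Qed.

Lemma lower_edges_jsums (x a : int) : a \in lower_edges x ->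
  (x \in jsums k A) && (x + a \in jsums k.+1 A).
Proof.
rewrite !inE /= => /andP[aA /in_jsums[S [SA cardS ->]]].
move: SA; rewrite fsubsetD1 => /andP[SA aS].
apply/andP; split; apply/in_jsums; first by exists S.
exists (a |` S); split; last by rewrite big_fsetU1 // addrC.
  by rewrite fsubUset fsub1set aA.
by rewrite cardfsU1 aS cardS.
Qed.

Lemma card_jsumsS_weights :
  (#|` jsums k.+1 A|)%:R =
    \sum_(x <- jsums k A) \sum_(a <- A | a \in lower_edges x)
      (#|` upper_edges (x + a)|)%:R^-1 :> rat.
Proof.
transitivity (\sum_(y <- jsums k.+1 A) \sum_(a <- A | a \in upper_edges y)
                 (#|` upper_edges y|)%:R^-1 : rat).
  rewrite card_fset_sum1 natr_sum big_seq [RHS]big_seq.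
  apply: eq_bigr => y /card_upper_edges_jsums cardy.
  rewrite sum_fset_sub ?fset_sub //.
  rewrite sum_fset_const mulfV //.
  by rewrite pnatr_eq0 -lt0n (leq_trans _ cardy).
under eq_bigr do rewrite big_mkcond /=.
under [RHS]eq_bigr do rewrite big_mkcond /=.
rewrite exchange_big [RHS]exchange_big /=.
apply: eq_bigr => a _; rewrite -!big_mkcond big_fset_condE [RHS]big_fset_condE.
set X := [fset x in jsums k A | a \in lower_edges x].
transitivity (\sum_(y <- [fset x + a | x in X])
                 (#|` upper_edges y|)%:R^-1 : rat); last first.
  by rewrite big_imfset //= => x y _ _ /addIr.
apply: eq_fbigl => y; apply/idP/imfsetP => [|[x /=]].
  rewrite -[y](subrK a); set x := y - a; rewrite in_fset inE /= => /andP[_].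
  rewrite mem_upper_edges => ax; exists x => //.
  by rewrite in_fset inE /= ax; case/andP: (lower_edges_jsums ax) => ->.
rewrite in_fset inE /= => /andP[_ ax ->].
rewrite in_fset inE /= mem_upper_edges ax.
by case/andP: (lower_edges_jsums ax) => _ ->.
Qed.

End EdgeWeights.

Lemma lower_weight_le (k : nat) (A : {fset int}) (x : int) :
  (k ^ 2 + 7 * k <= 2 * #|` A|)%N -> x \in jsums k A ->
  \sum_(a <- A | a \in lower_edges k A x)
     (#|` upper_edges k A (x + a)|)%:R^-1
    <= ((#|` A|)%:R - k%:R) / (k%:R + 1) :> rat.
Proof.
move=> cardA_ge /in_jsums[S [SA cardS defx]].
have inv_upper_le m a :
    (m < #|` upper_edges k A (x + a)|)%N ->
    (#|` upper_edges k A (x + a)|)%:R^-1 <= (m%:R + 1)^-1 :> rat.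
  move=> ltm; rewrite natr1 lef_pV2 ?ler_nat // posrE ltr0n //.
  exact: leq_trans ltm.
have upper_ge a : a \in lower_edges k A x ->
    (#|` upper_edges k A (x + a)|)%:R^-1 <= (k%:R + 1)^-1 :> rat.
  move=> /lower_edges_jsums/andP[_ /card_upper_edges_jsums ltk].
  exact: inv_upper_le.
have k1_gt0 : 0 < k%:R + 1 :> rat by rewrite natr1 ltr0n.
have [[T [TA cardT sumT neqTS]] | uniqS] :
    (exists T : {fset int},
       [/\ T `<=` A, #|` T| = k, \sum_(z <- T) z = x & T != S]) \/
    (forall T : {fset int},
       T `<=` A -> #|` T| = k -> \sum_(z <- T) z = x -> T = S).
- have [/existsP[T /and3P[/eqP cardT /eqP sumT neqTS]] | uniqS] :=
    boolP [exists T : fpowerset A, [&& #|` val T| == k,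
                                       \sum_(z <- val T) z == x & val T != S]].
    by left; exists (val T); split=> //; rewrite -fpowersetE fsvalP.
  right=> T TA cardT sumT; apply: contraNeq uniqS => neqTS.
  have PT : T \in fpowerset A by rewrite fpowersetE.
  by apply/existsP; exists [` PT]; rewrite /= cardT sumT neqTS !eqxx.
- pose U := S `|` T.
  have UA : U `<=` A by rewrite fsubUset SA.
  have cardU : (#|` U| <= 2 * k)%N by have := cardfsUI S T; rewrite -/U; lia.
  have cardAU : #|` A `\` U| = (#|` A| - #|` U|)%N by rewrite cardfsDS.
  have leUA := fsubset_leq_card UA.
  pose w a : rat := if a \in U then (k%:R + 1)^-1 else (k%:R + 3)^-1.
  apply: (@le_trans _ _ (\sum_(a <- A) w a)).
    rewrite [leRHS](bigID (mem (lower_edges k A x))) /= -[leLHS]addr0.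
    rewrite lerD //; last first.
      apply: sumr_ge0 => a _; rewrite /w.
      by case: ifP => _; rewrite invr_ge0 addr_ge0.
    rewrite big_seq_cond [leRHS]big_seq_cond.
    apply: ler_sum => a /andP[aA alow].
    rewrite /w; case: ifPn => [_|]; first exact: upper_ge.
    rewrite inE negb_or => /andP[aS aT].
    have -> : k%:R + 3 = k.+2%:R + 1 :> rat by rewrite -addn2 natrD; ring.
    apply: inv_upper_le.
    have cardaS : #|` a |` S| = k.+1 by rewrite cardfsU1 aS cardS.
    have cardaT : #|` a |` T| = k.+1 by rewrite cardfsU1 aT cardT.
    have neq : a |` S != a |` T.
      apply: contra neqTS => /eqP eqaST; apply/eqP.
      by rewrite -(fsetU1K aT) -eqaST fsetU1K.
    have := cardfsU_eq_sum neq.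
    rewrite cardaS cardaT !big_fsetU1 // sumT -defx => /(_ erefl erefl).
    move=> /leq_trans; apply; apply: fsubset_leq_card.
    rewrite fsubUset; apply/andP.
    by split; [rewrite defx | rewrite -sumT]; apply: sub_upper_edgesU1.
  have -> : \sum_(a <- A) w a = (#|` U|)%:R / (k%:R + 1)
                               + (#|` A `\` U|)%:R / (k%:R + 3).
    rewrite (big_fsetID _ (mem U)) /=.
    have -> : [fset a in A | a \in U] = U.
      apply/fsetP => a; rewrite in_fset [LHS]inE /= andb_idl //.
      exact: (fsubsetP UA).
    have -> : [fset a in A | a \notin U] = A `\` U.
      by apply/fsetP => a; rewrite in_fsetD in_fset [LHS]inE /= andbC.
    rewrite -!sum_fset_const; congr (_ + _); apply: eq_fbigr => a; rewrite /w.
      by move=> ->.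
    by rewrite in_fsetD => /andP[/negPf ->].
  rewrite cardAU natrB // ler_pdivlMr //.
  move: cardA_ge cardU; rewrite -(ler_nat rat) natrD natrX !natrM.
  rewrite -[(_ <= 2 * k)%N](ler_nat rat) natrM.
  move: #|` A|%:R #|` U|%:R k1_gt0 => N u; move: k%:R => K K1 hN hu.
  have K3 : 0 < K + 3 by lra.
  rewrite mulrDl divfK ?gt_eqF // mulrAC -lerBrDl ler_pdivrMr //.
  nra.
- have lowerS : lower_edges k A x `<=` A `\` S.
    apply/fsubsetP => a; rewrite in_fset inE /= => /andP[aA].
    case/in_jsums => T [+ cardT sumT].
    rewrite fsubsetD1 => /andP[TA aT].
    by rewrite aA -(uniqS T) ?aT.
  apply: (@le_trans _ _ (\sum_(a <- lower_edges k A x) (k%:R + 1)^-1)).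
    rewrite sum_fset_sub ?fset_sub // big_seq [leRHS]big_seq.
    exact: ler_sum.
  have lekA : (k <= #|` A|)%N by rewrite -cardS fsubset_leq_card.
  rewrite sum_fset_const ler_wpM2r ?invr_ge0 ?(ltW k1_gt0) // -natrB // ler_nat.
  by have := fsubset_leq_card lowerS; rewrite cardfsDS // cardS.
Qed.

Theorem theorem1 (k n : nat) (A : {fset int}) (hA : #|` A| = n)
  (hn : ((k%:R ^+ 2 + 7 * k%:R) / 2 : rat) <= n%:R) :
  ((#|` jsums k.+1 A|)%:R / (#|` jsums k A|)%:R : rat)
    <= (n%:R - k%:R) / (k%:R + 1).
Proof.
have k1_gt0 : 0 < k%:R + 1 :> rat by rewrite natr1 ltr0n.
have cardA_ge : (k ^ 2 + 7 * k <= 2 * #|` A|)%N.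
  by rewrite -(ler_nat rat) natrD natrX !natrM hA; lra.
have [->|J_gt0] := posnP #|` jsums k A|.
  by rewrite invr0 mulr0 divr_ge0 ?(ltW k1_gt0) // subr_ge0 ler_nat; nia.
rewrite ler_pdivrMr ?ltr0n // card_jsumsS_weights -hA.
rewrite [X in _ <= _ * X%:R]card_fset_sum1 natr_sum mulr_sumr.
rewrite big_seq [leRHS]big_seq; apply: ler_sum => x xJ.
by rewrite mulr1 lower_weight_le.
Qed.
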